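(* Let $k\ge2$ and let $s,q\in\mathbb{C}$ be such that $[r]\neq0$ for $1\le r\le k$, $1+s[n]\ne0$ for every positive integer $n$, and $1-q+s\neq 0$, where $[n]=1+q+\cdots+q^{n-1}$. Set $$\nu:=\frac{s}{1-q+s}.$$ Let $z=(z_1,\dots,z_k)$ be a tuple of distinct complex numbers with $z_i\neq1$ and $\nu z_i\neq1$ for all $i$. Then the function $\Psi_z$ on $L_+$ defined by $$\Psi_z:=\sum_{\sigma\in\mathfrak{S}_k}\ \prod_{1\le i<j\le k}\frac{qz_{\sigma(i)}-z_{\sigma(j)}}{z_{\sigma(i)}-z_{\sigma(j)}}\ \prod_{i=1}^k\left(\frac{1-\nu z_{\sigma(i)}}{1-z_{\sigma(i)}}\right)^{\epsilon_i}$$ satisfies $$\mathcal{H}(s,q)\Psi_z=(\nu-1)\sum_{i=1}^k\frac{z_i}{1-\nu z_i}\,\Psi_z .$$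
   Context: $L=\bigoplus_{i=1}^k\mathbb{Z}v_i$ is the free abelian group on $v_1,\dots,v_k$, with coordinate functions $\epsilon_i$ ($\epsilon_i(v_j)=1$ if $i=j$, else $0$). $L_+=\{x\in L\mid\epsilon_1(x)\ge\cdots\ge\epsilon_k(x)\}$, and $F(L_+)$ is the space of functions $L_+\to\mathbb{C}$. At $x\in L_+$ the exponent $\epsilon_i$ takes the value $\epsilon_i(x)$. For $x\in L_+$, its cluster coordinate is the tuple $(c_1,\dots,c_M)$ of positive integers with $\sum_{i=1}^M c_i=k$, $\epsilon_{c_1}(x)>\epsilon_{c_1+c_2}(x)>\cdots>\epsilon_{c_1+\cdots+c_M}(x)$, and $\epsilon_j(x)=\epsilon_{c_1+\cdots+c_i}(x)$ whenever $c_1+\cdots+c_{i-1}<j\le c_1+\cdots+c_i$. The operator $\mathcal{H}(s,q)$ on $F(L_+)$ is $$(\mathcal{H}(s,q)f)(x)=\sum_{i=1}^M\sum_{r=1}^{c_i}\frac{s^{r-1}}{[r]}\prod_{p=0}^{r-1}\frac{[c_i-p]}{1+s[c_i-1-p]}\Bigl(f\bigl(x-\sum_{p=0}^{r-1}v_{c_1+\cdots+c_i-p}\bigr)-f(x)\Bigr),$$ where $(c_1,\dots,c_M)$ is the cluster coordinate of $x$. (It is the backward generator of a continuous-time particle system in which $r$ particles jump one site to the left from a cluster of $c$ particles with rate $\frac{s^{r-1}}{[r]}\prod_{p=0}^{r-1}\frac{[c-p]}{1+s[c-1-p]}$.) *)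

(* Defs.v *)
From HB Require Import structures.
From mathcomp Require Import all_boot all_order all_algebra all_fingroup.
From mathcomp Require Import zify lra.

Set Implicit Arguments.
Unset Strict Implicit.
Unset Printing Implicit Defensive.

Import Order.TTheory GRing.Theory Num.Theory.
Local Open Scope ring_scope.

(* The lattice L is 'rV[int]_k.  The index j of basis_vec k j is 1-based, as in
   v_1, ..., v_k, whereas coordinates are indexed by 'I_k, so that the value of
   epsilon_i at x is x 0 (i - 1). *)
Definition basis_vec (k j : nat) : 'rV[int]_k := \row_(l < k) (l.+1 == j)%:R.

Definition dominant (k : nat) (x : 'rV[int]_k) : bool :=
  [forall i : 'I_k, forall j : 'I_k, (i <= j)%N ==> (x 0 j <= x 0 i)].

Definition Lplus (k : nat) : Type := {x : 'rV[int]_k | dominant x}.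

(* csum c i = c_1 + ... + c_i. *)
Definition csum (c : seq nat) (i : nat) : nat := sumn (take i c).

(* Since coordinates are 0-based, the i-th cluster (i counted from 0) occupies
   the coordinates j with csum c i <= j < csum c i.+1. *)
Definition is_cluster_coord (k : nat) (x : 'rV[int]_k) (c : seq nat) : Prop :=
  [/\ all (fun n => 0 < n)%N c,
      sumn c = k,
      forall (i : nat) (a b : 'I_k), (i.+1 < size c)%N ->
        a.+1 = csum c i.+1 -> b.+1 = csum c i.+2 -> x 0 b < x 0 a
    & forall (i : nat) (j b : 'I_k), (i < size c)%N ->
        (csum c i <= j < csum c i.+1)%N -> b.+1 = csum c i.+1 ->
        x 0 j = x 0 b].

Definition seq_clusters (e : seq int) : seq nat :=
  [seq count_mem a e | a <- undup e].

Definition cluster_coord (k : nat) (x : Lplus k) : seq nat :=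
  seq_clusters [seq sval x 0 i | i <- enum 'I_k].

Section SeqClusters.

Let S := csum.

Definition spec (e : seq int) (c : seq nat) : Prop :=
  [/\ all (fun n => 0 < n)%N c,
      sumn c = size e,
      forall i, (i.+1 < size c)%N ->
        nth 0 e (S c i.+2).-1 < nth 0 e (S c i.+1).-1
    & forall i j, (i < size c)%N -> (S c i <= j < S c i.+1)%N ->
        nth 0 e j = nth 0 e (S c i.+1).-1].

Lemma csum_cons n c i : csum (n :: c) i.+1 = (n + csum c i)%N.
Proof. by []. Qed.

Lemma csumS c i : csum c i.+1 = (csum c i + nth 0%N c i)%N.
Proof.
elim: c i => [|n c IH] [|i] //=; first by rewrite /csum /= take0 /= addn0.
by rewrite !csum_cons IH addnA.
Qed.

Lemma csum_le c i j : (i <= j)%N -> (csum c i <= csum c j)%N.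
Proof.
move=> /subnK <-; elim: (j - i)%N => // d IH.
by rewrite addSn csumS; lia.
Qed.

Lemma csum_size c : csum c (size c) = sumn c.
Proof. by rewrite /csum take_size. Qed.

Lemma csum_sumn c i : (csum c i <= sumn c)%N.
Proof.
rewrite -csum_size; case: (leqP i (size c)) => [/csum_le //|/ltnW h].
by rewrite /csum take_oversize // take_size.
Qed.

Lemma csum_find c j : (j < sumn c)%N ->
  exists2 i, (i < size c)%N & (csum c i <= j < csum c i.+1)%N.
Proof.
elim: c j => [|n c IH] j //= hj.
case: (ltnP j n) => hjn.
  by exists 0%N; rewrite // csum_cons /csum /= take0 /=; lia.
have [|i hi /andP[h1 h2]] := IH (j - n)%N; first by lia.
by exists i.+1; rewrite // !csum_cons; lia.
Qed.

Lemma sorted_nth (e : seq int) i j : sorted >=%R e ->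
  (i <= j)%N -> (j < size e)%N -> nth 0 e j <= nth 0 e i.
Proof.
move=> se ij je.
have := sorted_leq_nth (ge_trans (T := int)) (ge_refl (T := int)) 0 se.
by apply; rewrite ?inE //; exact: leq_ltn_trans ij je.
Qed.

Lemma spec_sep (e : seq int) c i j l : sorted >=%R e -> spec e c ->
  (i < size c)%N -> (j < S c i.+1 <= l)%N -> (l < size e)%N ->
  nth 0 e l < nth 0 e j.
Proof.
move=> se [pos sz strict eqc] ic /andP[jS Sl] le.
have i1 : (i.+1 < size c)%N.
  rewrite ltn_neqAle ic andbT; apply/eqP => E.
  by move: Sl; rewrite /S E csum_size sz; lia.
have ci : (0 < nth 0%N c i.+1)%N by apply: (all_nthP 0%N pos).
have SS := csumS c i.+1; rewrite -/S in SS.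
have h1 := strict i i1.
have h2 : nth 0 e (S c i.+1) = nth 0 e (S c i.+2).-1.
  by apply: (eqc i.+1) => //; lia.
have h3 : nth 0 e l <= nth 0 e (S c i.+1) by apply: sorted_nth.
have h4 : nth 0 e (S c i.+1).-1 <= nth 0 e j by apply: sorted_nth => //; lia.
by apply: le_lt_trans h3 _; rewrite h2; apply: lt_le_trans h1 h4.
Qed.

Lemma spec_nil e : spec e [::] -> e = [::].
Proof. by case=> _ /= /esym/size0nil. Qed.

Lemma spec_uncons e n c : sorted >=%R e -> spec e (n :: c) ->
  exists a e', [/\ e = nseq n a ++ e', (0 < n)%N, all (fun b => b < a) e',
                   sorted >=%R e' & size e' = sumn c].
Proof.
move=> se sp; have [/= /andP[n0 pos] sz strict eqc] := sp.
have nsz : (n <= size e)%N by rewrite -sz leq_addr.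
exists (nth 0 e 0), (drop n e).
have S1 : S (n :: c) 1 = n by rewrite /S csum_cons /csum take0 addn0.
split => //.
- rewrite -{1}(cat_take_drop n e); congr (_ ++ _).
  apply: (@eq_from_nth _ 0); rewrite size_takel ?size_nseq //.
  move=> i hi; rewrite nth_take // nth_nseq hi.
  have E j : (j < n)%N -> nth 0 e j = nth 0 e n.-1.
    by move=> hj; rewrite (eqc 0%N) ?S1 // /S /csum take0 /=; lia.
  by rewrite !E.
- apply/(all_nthP 0) => i; rewrite size_drop nth_drop => hi.
  apply: (@spec_sep e (n :: c) 0) => //.
    by rewrite S1 n0 leq_addr.
  by rewrite -ltn_subRL.
- exact: drop_sorted.
- by rewrite size_drop -sz; lia.
Qed.

Lemma spec_cat n a e' c : (0 < n)%N -> all (fun b => b < a) e' ->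
  spec (nseq n a ++ e') (n :: c) <-> spec e' c.
Proof.
move=> n0 lta.
have N j : nth 0 (nseq n a ++ e') (n + j) = nth 0 e' j.
  by rewrite nth_cat size_nseq ltnNge leq_addr /= addKn.
have N0 j : (j < n)%N -> nth 0 (nseq n a ++ e') j = a.
  by move=> h; rewrite nth_cat size_nseq h nth_nseq h.
have S1 : S (n :: c) 1 = n by rewrite /S csum_cons /csum take0 addn0.
have P i : all (fun m => 0 < m)%N c -> (i < size c)%N -> (0 < S c i.+1)%N.
  by move=> /(all_nthP 0%N) h /h; rewrite /S csumS; lia.
have NS i : all (fun m => 0 < m)%N c -> (i < size c)%N ->
  nth 0 (nseq n a ++ e') (S (n :: c) i.+2).-1 = nth 0 e' (S c i.+1).-1.
  move=> h h'; have := P i h h'; rewrite {2}/S csum_cons -/(S c i.+1) => hp.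
  by rewrite -N; congr nth; lia.
split=> [[/= /andP[_ pos] sz strict eqc]|[pos sz strict eqc]].
- split => //.
  + by move: sz; rewrite size_cat size_nseq; lia.
  + by move=> i hi; rewrite -!NS ?(ltnW hi) //; apply: (strict i.+1).
  + move=> i j hi hj; rewrite -NS // -N; apply: (eqc i.+1) => //.
    by rewrite /S !csum_cons -/(S c i); move: hj; rewrite /S; lia.
- split => //=.
  + by rewrite n0.
  + by rewrite size_cat size_nseq sz.
  + case=> [|i] hi.
    2: by have hi' : (i.+1 < size c)%N := hi; rewrite !NS ?(ltnW hi') //; apply: strict.
    rewrite S1 NS // N0; last by lia.
    apply: (all_nthP 0 lta); rewrite -sz.
    by have := P 0%N pos hi; have := csum_sumn c 1; rewrite /S; lia.
  + case=> [|i] j hi; first by rewrite S1 /S /csum take0 /= => hj; rewrite !N0 //; lia.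
    rewrite {1 2}/S !csum_cons => hj; rewrite NS //.
    have -> : j = (n + (j - n))%N by lia.
    by rewrite N; apply: eqc => //; rewrite /S; lia.
Qed.

Lemma seq_clusters_cat n a e' : (0 < n)%N -> all (fun b => b < a) e' ->
  seq_clusters (nseq n a ++ e') = n :: seq_clusters e'.
Proof.
move=> n0 lta.
have ane : a \notin e' by apply/negP => /(allP lta); rewrite ltxx.
have U : undup (nseq n a ++ e') = a :: undup e'.
  case: n n0 => // n _; elim: n => [|n IH] /=; first by rewrite (negPf ane).
  by move: IH => /= ->; rewrite inE eqxx.
rewrite /seq_clusters U /= count_cat count_nseq /= eqxx mul1n.
rewrite (count_memPn ane) addn0; congr cons.
apply/eq_in_map => b; rewrite mem_undup => be.
rewrite count_cat count_nseq /=; suff -> : (a == b) = false by [].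
by apply/eqP => E; rewrite E be in ane.
Qed.

Lemma spec_clusters e c : sorted >=%R e -> spec e c -> c = seq_clusters e.
Proof.
elim: c e => [|n c IH] e se sp; first by rewrite (spec_nil sp).
have [a [e' [E n0 lta se' _]]] := spec_uncons se sp.
rewrite E seq_clusters_cat //; congr cons; apply: IH => //.
by apply/(spec_cat c n0 lta); rewrite -E.
Qed.

Lemma clusters_spec e : sorted >=%R e -> spec e (seq_clusters e).
Proof.
have [m] := ubnP (size e); elim: m e => // m IH [|a e] hs se.
  by split.
pose n := count_mem a (a :: e); pose e' := [seq b <- a :: e | b != a].
have n0 : (0 < n)%N by rewrite /n /= eqxx.
have lta : all (fun b => b < a) e'.
  apply/allP => b; rewrite mem_filter => /andP[ba].
  rewrite inE (negPf ba) /= => be; rewrite lt_neqAle ba.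
  by move: se => /= /(order_path_min (ge_trans (T := int)))/allP; apply.
have E : a :: e = nseq n a ++ e'.
  apply: (@sorted_eq _ >=%R).
  - exact: ge_trans.
  - by move=> x y /=; rewrite andbC => /le_anti.
  - exact: se.
  - have se' : sorted >=%R e' by apply: sorted_filter se; apply: ge_trans.
    case: (n) => //= d; elim: d => [|d IHd] /=; last by rewrite lexx IHd.
    rewrite path_min_sorted //; apply/allP => b /(allP lta); exact: ltW.
  - have -> : nseq n a = [seq b <- a :: e | b == a].
      rewrite /n -size_filter; apply/esym/all_pred1P/allP => b.
      by rewrite mem_filter => /andP[].
    by rewrite perm_sym perm_filterC.
rewrite E seq_clusters_cat //; apply/spec_cat => //; apply: IH.
  by move: hs; rewrite E size_cat size_nseq; lia.
by move: se; rewrite E; case/cat_sorted2.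
Qed.

End SeqClusters.

Section Clusters.

Variable k : nat.
Implicit Types (x : 'rV[int]_k) (c : seq nat).

Let coords x := [seq x 0 i | i <- enum 'I_k].

Let size_coords x : size (coords x) = k.
Proof. by rewrite size_map size_enum_ord. Qed.

Let nth_coords x (i : 'I_k) : nth 0 (coords x) i = x 0 i.
Proof. by rewrite (nth_map i) ?size_enum_ord // nth_ord_enum. Qed.

Let sorted_coords x : dominant x -> sorted >=%R (coords x).
Proof.
move=> /forallP dx; apply/(sortedP 0) => i; rewrite size_coords => hi.
have h : (i < k)%N by lia.
rewrite -[i.+1]/(val (Ordinal hi)) nth_coords -[i]/(val (Ordinal h)) nth_coords.
by have /forallP/(_ (Ordinal hi))/implyP := dx (Ordinal h); apply => /=.
Qed.

Let is_cluster_coord_spec x c : is_cluster_coord x c <-> spec (coords x) c.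
Proof.
have B i : all (fun n => 0 < n)%N c -> sumn c = k -> (i < size c)%N ->
    exists b : 'I_k, b.+1 = csum c i.+1.
  move=> /(all_nthP 0%N) h sz /h; have := csumS c i; have := csum_sumn c i.+1.
  move=> h1 h2 h3; have hb : ((csum c i.+1).-1 < k)%N by lia.
  by exists (Ordinal hb) => /=; lia.
split=> [[pos sz strict eqc]|[pos sz strict eqc]]; split => //.
- by rewrite size_coords.
- move=> i hi; have [a ha] := B i pos sz (ltnW hi).
  have [b hb] := B i.+1 pos sz hi.
  by rewrite -ha -hb /= !nth_coords; apply: (strict i).
- move=> i j hi hj; have [b hb] := B i pos sz hi.
  have hk : (j < k)%N by have := csum_sumn c i.+1; lia.
  rewrite -hb /= -[j]/(val (Ordinal hk)) !nth_coords; exact: (eqc i).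
- by rewrite sz size_coords.
- move=> i a b hi ha hb; have := strict i hi.
  by rewrite -ha -hb /= !nth_coords.
- move=> i j b hi hj hb; have := eqc i j hi hj.
  by rewrite -hb /= !nth_coords.
Qed.

Lemma cluster_coordP (x : Lplus k) c :
  is_cluster_coord (sval x) c <-> c = cluster_coord x.
Proof.
case: x => x dx; rewrite /cluster_coord /=; split.
  by move/is_cluster_coord_spec; apply: spec_clusters; apply: sorted_coords.
by move=> ->; apply/is_cluster_coord_spec/clusters_spec/sorted_coords.
Qed.

Lemma cluster_coord_le (x : Lplus k) i :
  (nth 0%N (cluster_coord x) i <= csum (cluster_coord x) i.+1 <= k)%N.
Proof.
have [_ sz _ _] := (cluster_coordP x _).2 erefl.
by rewrite (leq_trans (csum_sumn _ _)) ?sz // csumS leq_addl.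
Qed.

Lemma cluster_sep (x : Lplus k) i (a b : 'I_k) :
  (i < size (cluster_coord x))%N ->
  (a < csum (cluster_coord x) i.+1 <= b)%N -> sval x 0 b < sval x 0 a.
Proof.
move=> hi hab; have /is_cluster_coord_spec sp := (cluster_coordP x _).2 erefl.
rewrite -!nth_coords; apply: spec_sep sp hi hab _.
  by apply: sorted_coords; exact: proj2_sig x.
by rewrite size_coords.
Qed.

Lemma sum_basis_vecE m r (l : 'I_k) : (r <= m)%N ->
  (\sum_(p < r) basis_vec k (m - p)) 0 l = (m - r <= l < m)%N%:R.
Proof.
move=> rm; rewrite summxE.
under eq_bigr do rewrite mxE.
case: (boolP (m - r <= l < m)%N) => [/andP[h1 h2]|h] /=.
  have hp : (m - l.+1 < r)%N by lia.
  rewrite (bigD1 (Ordinal hp)) //= big1 ?addr0.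
    by have -> : (l.+1 == m - (m - l.+1))%N by lia.
  move=> p /eqP pn; case: eqP => // E; case: pn; apply: val_inj => /=; lia.
rewrite big1 // => p _; case: eqP => // E.
by move: h; have := ltn_ord p; lia.
Qed.

End Clusters.

(* Here i and r are 0-based: they stand for the i + 1 and r + 1 of the formula. *)
Lemma jump_dominant (k : nat) (x : Lplus k) (i : 'I_(size (cluster_coord x)))
    (r : 'I_(nth 0%N (cluster_coord x) i)) :
  dominant (sval x -
    \sum_(p < r.+1) basis_vec k (csum (cluster_coord x) i.+1 - p)).
Proof.
have /andP[cm mk] := cluster_coord_le x i.
have rm := leq_trans (ltn_ord r) cm.
apply/forallP => a; apply/forallP => b; apply/implyP => ab.
have le_ba : sval x 0 b <= sval x 0 a.
  by case: (x) => y /= /forallP/(_ a)/forallP/(_ b)/implyP; apply.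
have sep := @cluster_sep k x i a b (ltn_ord i).
rewrite mxE [X in _ + X <= _]mxE sum_basis_vecE //.
rewrite [leRHS]mxE [X in _ <= _ + X]mxE sum_basis_vecE //.
set m := csum _ _ in rm sep *.
case: (boolP (m - r.+1 <= a < m)%N) => ha; case: (boolP (m - r.+1 <= b < m)%N) => hb /=.
- by rewrite lerD2r.
- by have := sep ltac:(lia); lia.
- by lia.
- by rewrite lerD2r.
Qed.

Definition jump (k : nat) (x : Lplus k) (i : 'I_(size (cluster_coord x)))
    (r : 'I_(nth 0%N (cluster_coord x) i)) : Lplus k :=
  exist (fun y : 'rV[int]_k => dominant y) _ (jump_dominant r).

Section Operator.

Variable C : fieldType.
Implicit Types s q nu : C.

Definition qint q (n : nat) : C := \sum_(i < n) q ^+ i.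

Definition jump_rate s q (c r : nat) : C :=
  s ^+ r.-1 / qint q r *
  \prod_(p < r) (qint q (c - p) / (1 + s * qint q (c - 1 - p))).

Definition generator (k : nat) s q (f : Lplus k -> C) (x : Lplus k) : C :=
  \sum_(i < size (cluster_coord x))
    \sum_(r < nth 0%N (cluster_coord x) i)
      jump_rate s q (nth 0%N (cluster_coord x) i) r.+1 * (f (jump r) - f x).

Definition Psi (k : nat) q nu (z : 'I_k -> C) (x : Lplus k) : C :=
  \sum_(sigma : 'S_k)
    (\prod_(i < k) \prod_(j < k | (i < j)%N)
       ((q * z (sigma i) - z (sigma j)) / (z (sigma i) - z (sigma j)))) *
    \prod_(i < k)
       ((1 - nu * z (sigma i)) / (1 - z (sigma i))) ^ (sval x 0 i).

End Operator.

(* Main.v *)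
Require Import Defs.
From mathcomp Require Import all_boot all_order all_algebra all_fingroup.
From mathcomp Require Import reals complex.
From mathcomp Require Import zify ring.

Set Implicit Arguments.
Unset Strict Implicit.
Unset Printing Implicit Defensive.

Import Order.TTheory GRing.Theory Num.Theory.
Local Open Scope ring_scope.

(** Put [u_j = 1 / y_j - 1], where [y_j = (1 - nu z_(sigma j)) / (1 - z_(sigma j))]
    is raised to the exponent [epsilon_j] in [Psi].  When two neighbours
    [i, i + 1] lie in the same cluster, exchanging [sigma i] and
    [sigma (i + 1)] shows that, against every factor invariant under this
    exchange, [u_i] may be replaced under the sum over [sigma] by
    [q u_(i+1) + s u_i u_(i+1)]: up to a symmetric denominator the difference is
    a multiple of [z_(sigma i) - q z_(sigma (i+1))], which the scattering factor
    turns into an antisymmetric expression.  Iterating,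
    [u_a = q^n u_(a+n) + s [n] u_a u_(a+n)] inside a cluster, i.e.
    [(1 + s [n]) u_a = q^n u_(a+n) + s [n] u_a (1 + u_(a+n))].  Unfolding the
    last identity expresses [u_a] through the products of the [1 + u_j] over the
    end of the cluster, and these products are what the jumps produce.  The
    rates of a cluster of size [c + 1] and of size [c] differ exactly by the
    coefficients found, so by induction on the size the jumps out of a cluster
    act as the sum of its [u_j]; summed over the clusters this is a symmetric
    function of [z], namely the eigenvalue. *)

(** * [q]-integers, and the jump rates as a function of the cluster size *)

Section QInt.

Variables (F : fieldType) (s q : F).

Lemma qint0 : qint q 0 = 0.
Proof. exact: big_ord0. Qed.

Lemma qintD m n : qint q (m + n) = qint q m + q ^+ m * qint q n.
Proof.
rewrite /qint big_split_ord /= big_distrr /=; congr (_ + _).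
by apply: eq_bigr => i _; rewrite exprD.
Qed.

Lemma qint1 : qint q 1 = 1.
Proof. by rewrite /qint big_ord1. Qed.

Lemma qintS n : qint q n.+1 = 1 + q * qint q n.
Proof. by rewrite -add1n qintD qint1 expr1. Qed.

(* Coefficient of the term carrying [j] factors [1 + u] when [u_a] is expanded
   over the positions [a, ..., a + n]. *)
Definition tail_coef n j : F :=
  q ^+ (n - j) * s ^+ j * (\prod_(p < j) qint q (n - p)) /
  \prod_(p < j.+1) (1 + s * qint q (n - p)).

Hypothesis sq_neq0 : forall n, (0 < n)%N -> 1 + s * qint q n != 0.

Lemma onesq_neq0 n : 1 + s * qint q n != 0.
Proof.
by case: n => [|n]; [rewrite qint0 mulr0 addr0 oner_neq0 | exact: sq_neq0].
Qed.

Lemma tail_coef0 n : tail_coef n 0 = q ^+ n / (1 + s * qint q n).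
Proof.
by rewrite /tail_coef big_ord0 big_ord1 subn0 expr0 !mulr1.
Qed.

Lemma tail_coefSS n j : tail_coef n.+1 j.+1 =
  s * qint q n.+1 / (1 + s * qint q n.+1) * tail_coef n j.
Proof.
rewrite /tail_coef !(big_ord_recl j) [in LHS](big_ord_recl j.+1) /= !subn0 subSS.
under [X in _ * (_ * X) / _]eq_bigr do rewrite subSS.
under [X in _ * _ / (_ * X)]eq_bigr do rewrite subSS.
rewrite (big_ord_recl j) /= subn0 exprS invfM; ring.
Qed.

(** After cancelling common products, an identity between [[n]], [[m]], [[r + 1]] and [q ^+ m]
    remains, with [m = n - r - 1]. *)
Lemma jump_rateS n r : (r <= n)%N -> qint q r.+1 != 0 ->
  jump_rate s q n.+1 r.+1 =
  jump_rate s q n r.+1 + tail_coef n r - tail_coef n r.+1.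
Proof.
move=> rn r_neq0; rewrite /jump_rate /tail_coef !prodf_div /=.
have Qn0 a b : \prod_(p < b) (1 + s * qint q (a - p)) != 0.
  by apply/prodf_neq0 => p _; exact: onesq_neq0.
have E1 : \prod_(p < r.+1) qint q (n.+1 - p) =
    qint q n.+1 * \prod_(p < r) qint q (n - p).
  by rewrite big_ord_recl subn0; congr (_ * _); apply: eq_bigr.
have E2 : \prod_(p < r.+2) (1 + s * qint q (n - p)) =
    \prod_(p < r.+1) (1 + s * qint q (n - p)) * (1 + s * qint q (n - r.+1)).
  by rewrite [LHS]big_ord_recr.
have E3 : \prod_(p < r.+1) (1 + s * qint q (n - 1 - p)) =
    \prod_(p < r.+1) (1 + s * qint q (n - p)) * (1 + s * qint q (n - r.+1))
     / (1 + s * qint q n).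
  rewrite -E2 [in RHS]big_ord_recl /= subn0 mulrAC divff ?onesq_neq0 // mul1r.
  by apply: eq_bigr => p _; rewrite -subnDA.
have E4 : \prod_(p < r.+1) qint q (n - p) =
    \prod_(p < r) qint q (n - p) * qint q (n - r).
  by rewrite [LHS]big_ord_recr.
rewrite E1 E3 subn1 E2 E4 /=.
have := Qn0 n r.+1.
set Q := \prod_(p < r.+1) _; set P := \prod_(p < r) _ => Q0.
(* The case [r = n] is apart because [n - r.+1] truncates; there the factor [[n - r] = 0] kills the
   first and last terms on the right. *)
move: rn; rewrite leq_eqVlt => /orP[/eqP E|rn].
  subst r; rewrite subnn qint0 expr0; have := onesq_neq0 n.
  have := onesq_neq0 (n - n.+1); set X := qint q (n - n.+1); move=> h1 h2.
  by field; rewrite Q0 r_neq0 h1 h2.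
have En : (n = (n - r.+1) + r.+1)%N by rewrite subnK.
have := onesq_neq0 n; have := onesq_neq0 (n - r.+1).
have -> : (n - r = (n - r.+1).+1)%N by lia.
have : qint q n = qint q (n - r.+1) + q ^+ (n - r.+1) * qint q r.+1.
  by rewrite -qintD -En.
set m := (n - r.+1)%N; rewrite (qintS n) (qintS m) => -> h1 h2.
(* Two expansions of [[m + 1]] express [q ^+ m] through [q] and [[m]]. *)
have EQ : qint q m.+1 = qint q m + q ^+ m by rewrite -addn1 qintD qint1 mulr1.
have EQ' : q ^+ m = 1 + q * qint q m - qint q m by rewrite -qintS EQ addrC addKr.
move: h2; rewrite !exprS EQ' => h2.
by field; rewrite Q0 r_neq0 h1 h2.
Qed.

End QInt.

(** * A single cluster, at positions [lo] to [hi - 1], under an abstract two-body relation *)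

Section TwoBody.

Variables (F : fieldType) (s q : F) (T : finType) (wt : T -> F).
Variables (swap : nat -> T -> T) (u : nat -> T -> F) (lo hi : nat).

Definition wsum (g : T -> F) : F := \sum_t wt t * g t.

Lemma eq_wsum f g : f =1 g -> wsum f = wsum g.
Proof. by move=> fg; apply: eq_bigr => t _; rewrite fg. Qed.

Lemma wsumD f g : wsum (fun t => f t + g t) = wsum f + wsum g.
Proof.
by rewrite /wsum -big_split; apply: eq_bigr => t _; rewrite mulrDr.
Qed.

Lemma wsumZ a f : wsum (fun t => a * f t) = a * wsum f.
Proof.
by rewrite /wsum big_distrr; apply: eq_bigr => t _ /=; rewrite mulrCA.
Qed.

Lemma wsumB f g : wsum (fun t => f t - g t) = wsum f - wsum g.
Proof.
rewrite -[- wsum g]mulN1r -wsumZ -wsumD.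
by apply: eq_wsum => t; rewrite mulN1r.
Qed.

(** Since [swap i] stands for exchanging [i] and [i + 1], the positions concerned are [a] to [b],
    both included. *)
Definition swap_inv a b (g : T -> F) :=
  forall i t, (a <= i < b)%N -> g (swap i t) = g t.

Hypothesis sq_neq0 : forall n, (0 < n)%N -> 1 + s * qint q n != 0.
Hypothesis u_swap : forall i j t, (lo <= i)%N -> (i.+1 < hi)%N ->
  (lo <= j < hi)%N -> j != i -> j != i.+1 -> u j (swap i t) = u j t.
Hypothesis two_body : forall i g, (lo <= i)%N -> (i.+1 < hi)%N ->
  (forall t, g (swap i t) = g t) ->
  wsum (fun t => g t * (u i t - q * u i.+1 t - s * u i t * u i.+1 t)) = 0.

Lemma two_bodyE i g : (lo <= i)%N -> (i.+1 < hi)%N ->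
  (forall t, g (swap i t) = g t) ->
  wsum (fun t => g t * u i t) =
  q * wsum (fun t => g t * u i.+1 t) +
  s * wsum (fun t => g t * u i.+1 t * u i t).
Proof.
move=> li ih gi; apply/eqP; rewrite -subr_eq0 -(two_body li ih gi).
rewrite -!wsumZ -wsumD -wsumB; apply/eqP/eq_wsum => t; ring.
Qed.

(** Lets the inductions absorb a position beyond [b] into [g], with [f] equal to 0 in [many_bodyE]
    and 1 in [wsum_expand]. *)
Lemma swap_invM a b g j : (lo <= a)%N -> (b < j < hi)%N ->
  swap_inv a b g -> forall f, swap_inv a b (fun t => g t * (f + u j t)).
Proof.
move=> la bj gi f i t abi; rewrite gi // u_swap //; lia.
Qed.

(** Induction on [n]: the two-body relation at [a + n] trades [u (a + n)] for [u (a + n.+1)]; the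
    leftover products recombine by the induction hypothesis for [g * u (a + n.+1)]. *)
Lemma many_bodyE n a g : (lo <= a)%N -> (a + n < hi)%N ->
  swap_inv a (a + n) g ->
  wsum (fun t => g t * u a t) =
  q ^+ n * wsum (fun t => g t * u (a + n) t) +
  s * qint q n * wsum (fun t => g t * u (a + n) t * u a t).
Proof.
elim: n g => [|n IH] g la nh gi.
  by rewrite addn0 qint0 expr0 mul1r mulr0 mul0r addr0.
have nh' : (a + n < hi)%N by lia.
have gi' : swap_inv a (a + n) g by move=> i t h; apply: gi; lia.
have gn t : g (swap (a + n) t) = g t by apply: gi; lia.
have E1 := IH g la nh' gi'.
have E2 := IH (fun t => g t * (0 + u (a + n.+1) t)) la nh'.
have jn : (a + n < a + n.+1 < hi)%N by lia.
have {}E2 := E2 (swap_invM la jn gi' 0).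
have E3 := @two_bodyE (a + n) g ltac:(lia) ltac:(lia) gn.
(* The invariant factor is now [g * u a], so [a] and [a + n] must differ; at [n = 0] the coefficient
   [[0]] removes the term. *)
have E4 : (0 < n)%N -> wsum (fun t => g t * u (a + n) t * u a t) =
  q * wsum (fun t => g t * u (a + n.+1) t * u a t) +
  s * wsum (fun t => g t * u (a + n.+1) t * u (a + n) t * u a t).
  move=> n0; have := @two_bodyE (a + n) (fun t => g t * u a t) ltac:(lia) ltac:(lia).
  rewrite -addnS => E; have {}E := E _.
  transitivity (wsum (fun t => g t * u a t * u (a + n) t)).
    by apply: eq_wsum => t; ring.
  rewrite E; last by move=> t; rewrite gn u_swap //; lia.
  by congr (_ * _ + _ * _); apply: eq_wsum => t; ring.
have E2' : wsum (fun t => g t * u (a + n.+1) t * u a t) =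
  q ^+ n * wsum (fun t => g t * u (a + n.+1) t * u (a + n) t) +
  s * qint q n * wsum (fun t => g t * u (a + n.+1) t * u (a + n) t * u a t).
  by under eq_wsum do rewrite -[u (a + n.+1) _]add0r; rewrite E2;
     congr (_ * _ + _ * _); apply: eq_wsum => t; rewrite add0r.
have E4' : qint q n * wsum (fun t => g t * u (a + n) t * u a t) = qint q n *
   (q * wsum (fun t => g t * u (a + n.+1) t * u a t) +
    s * wsum (fun t => g t * u (a + n.+1) t * u (a + n) t * u a t)).
  by case: (posnP n) => [->|/E4 -> //]; rewrite qint0 !mul0r.
rewrite E1 E3 -addnS qintS exprS -mulrA E4'.
set m4 := wsum (fun t => g t * u (a + n.+1) t * u a t).
rewrite [RHS](_ : _ = q * q ^+ n * wsum (fun t => g t * u (a + n.+1) t) +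
  s * m4 + s * q * qint q n * m4); last by ring.
by rewrite [s * m4](congr1 _ E2'); ring.
Qed.

(** The induction hypothesis is applied to [g * (1 + u (a + n.+1))], so each step adds one factor to
    the products. *)
Lemma wsum_expand n a g : (lo <= a)%N -> (a + n < hi)%N ->
  swap_inv a (a + n) g ->
  wsum (fun t => g t * u a t) =
  \sum_(j < n.+1) tail_coef s q n j * wsum (fun t =>
     g t * (u (a + n - j) t * \prod_(p < j) (1 + u (a + n - p) t))).
Proof.
elim: n g => [|n IH] g la nh gi.
  rewrite big_ord1 tail_coef0 qint0 mulr0 addr0 divr1 expr0 mul1r.
  by apply: eq_wsum => t; rewrite big_ord0 mulr1 addn0 subn0.
have nh' : (a + n < hi)%N by lia.
have gi' : swap_inv a (a + n) g by move=> i t h; apply: gi; lia.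
have jn : (a + n < a + n.+1 < hi)%N by lia.
have {}IH := IH _ la nh' (swap_invM la jn gi' 1).
rewrite big_ord_recl tail_coef0.
under eq_bigr => j _.
  rewrite tail_coefSS -mulrA.
  under eq_wsum => t.
    rewrite addnS subSS big_ord_recl subn0 /=.
    under eq_bigr do rewrite subSS.
    over.
  over.
rewrite -big_distrr /=.
have -> : \sum_(j < n.+1) tail_coef s q n j * wsum (fun t => g t *
    (u (a + n - j) t * ((1 + u (a + n).+1 t) *
      \prod_(p < j) (1 + u (a + n - p) t)))) =
    wsum (fun t => g t * (1 + u (a + n).+1 t) * u a t).
  rewrite -addnS IH; apply: eq_bigr => j _; congr (_ * _).
  by apply: eq_wsum => t; ring.
under [X in _ * X + _]eq_wsum do rewrite big_ord0 mulr1 subn0.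
have -> : wsum (fun t => g t * (1 + u (a + n).+1 t) * u a t) =
   wsum (fun t => g t * u a t) + wsum (fun t => g t * u (a + n).+1 t * u a t).
  by rewrite -wsumD; apply: eq_wsum => t; ring.
have E := many_bodyE la nh gi; have := onesq_neq0 sq_neq0 n.+1 => h.
apply: (mulfI h); rewrite mulrDl mul1r {1}E -addnS.
by field.
Qed.

Hypothesis q_neq0 : forall r, (0 < r <= hi)%N -> qint q r != 0.

(** Only the last [c] positions before [hi] enter: the induction enlarges the cluster leftwards with
    [hi] fixed. *)
Lemma wsum_cluster c : (lo + c <= hi)%N ->
  \sum_(r < c) jump_rate s q c r.+1 *
    wsum (fun t => \prod_(p < r.+1) (1 + u (hi - p.+1) t) - 1) =
  \sum_(i < c) wsum (u (hi - i.+1)).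
Proof.
elim: c => [|c IH] ch; first by rewrite !big_ord0.
pose W r := wsum (fun t => \prod_(p < r) (1 + u (hi - p.+1) t) - 1).
have W0 : W 0 = 0.
  by rewrite /W /wsum big1 // => t _; rewrite big_ord0 subrr mulr0.
rewrite [RHS]big_ord_recr /= -IH; last by lia.
have := @wsum_expand c (hi - c.+1) (fun=> 1) ltac:(lia) ltac:(lia) (fun _ _ _ => erefl).
under eq_wsum do rewrite mul1r.
move=> ->.
have -> : \sum_(j < c.+1) tail_coef s q c j * wsum (fun t =>
     1 * (u (hi - c.+1 + c - j) t *
       \prod_(p < j) (1 + u (hi - c.+1 + c - p) t))) =
   \sum_(j < c.+1) tail_coef s q c j * (W j.+1 - W j).
  apply: eq_bigr => j _; congr (_ * _); rewrite /W -wsumB.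
  apply: eq_wsum => t; rewrite big_ord_recr /=.
  have E p : (hi - c.+1 + c - p = hi - p.+1)%N by lia.
  by under eq_bigr do rewrite E; rewrite E; ring.
(* Both coefficients contain [[0] = 0], which settles the boundary terms of the summation by parts
   below. *)
have tc : tail_coef s q c c.+1 = 0.
  by rewrite /tail_coef big_ord_recr /= subnn qint0 mulr0 mulr0 mul0r.
have jc : jump_rate s q c c.+1 = 0.
  by rewrite /jump_rate big_ord_recr /= subnn qint0 mul0r !mulr0.
have -> : \sum_(r < c) jump_rate s q c r.+1 * W r.+1 =
  \sum_(r < c.+1) jump_rate s q c r.+1 * W r.+1.
  by rewrite big_ord_recr /= jc mul0r addr0.
under eq_bigr => r _.
  have rc : (r <= c)%N by rewrite -ltnS.
  rewrite (@jump_rateS _ s q sq_neq0 c r rc); last by apply: q_neq0; lia.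
  rewrite mulrBl mulrDl; over.
rewrite sumrB big_split /= -addrA; congr (_ + _).
under [RHS]eq_bigr do rewrite mulrBr.
rewrite sumrB; congr (_ - _).
rewrite [LHS]big_ord_recr /= tc mul0r addr0.
by rewrite [RHS]big_ord_recl /= W0 mulr0 add0r.
Qed.

End TwoBody.

(** * The two-body relation for the summands of [Psi] *)

Section Bethe.

Variables (F : numFieldType) (k : nat) (s q nu : F) (z : 'I_k.+1 -> F).
Variable e : 'I_k.+1 -> int.

Let y i := (1 - nu * z i) / (1 - z i).

Definition scat (sigma : 'S_k.+1) : F :=
  \prod_(i < k.+1) \prod_(j < k.+1 | (i < j)%N)
     ((q * z (sigma i) - z (sigma j)) / (z (sigma i) - z (sigma j))).

Definition bethe_wt (sigma : 'S_k.+1) : F :=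
  scat sigma * \prod_(i < k.+1) y (sigma i) ^ e i.

(* Positions are natural numbers; beyond [k] they are junk, by [inord]. *)
Definition hop (j : nat) (sigma : 'S_k.+1) : F := (y (sigma (inord j)))^-1 - 1.

(** Permutations compose from left to right, so the transposition acts on positions, not on
    values. *)
Definition swap (i : nat) (sigma : 'S_k.+1) : 'S_k.+1 :=
  (tperm (inord i) (inord i.+1) * sigma)%g.

Lemma swapK i : involutive (swap i).
Proof. by move=> sigma; rewrite /swap mulgA tperm2 mul1g. Qed.

Lemma swapL i sigma : swap i sigma (inord i) = sigma (inord i.+1).
Proof. by rewrite permM tpermL. Qed.

Lemma swapR i sigma : swap i sigma (inord i.+1) = sigma (inord i).
Proof. by rewrite permM tpermR. Qed.

Lemma hop_swap i j sigma : (i.+1 < k.+1)%N -> (j < k.+1)%N ->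
  j != i -> j != i.+1 -> hop j (swap i sigma) = hop j sigma.
Proof.
move=> ik jk ji ji1; rewrite /hop permM tpermD //.
  by apply: contra ji => /eqP/(congr1 val) /=; rewrite !inordK; lia.
by apply: contra ji1 => /eqP/(congr1 val) /=; rewrite !inordK; lia.
Qed.

(** Exchanging neighbouring positions keeps the order of every pair except [(i, i + 1)], so the
    other factors are merely permuted. *)
Lemma scat_swap i : (i.+1 < k.+1)%N -> exists2 rest : 'S_k.+1 -> F,
  forall sigma, rest (swap i sigma) = rest sigma &
  forall sigma, scat sigma = (q * z (sigma (inord i)) - z (sigma (inord i.+1)))
    / (z (sigma (inord i)) - z (sigma (inord i.+1))) * rest sigma.
Proof.
move=> ik; pose a : 'I_k.+1 := inord i; pose b : 'I_k.+1 := inord i.+1.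
have va : val a = i by rewrite /= inordK // ltnW.
have vb : val b = i.+1 by rewrite /= inordK.
pose G (sigma : 'S_k.+1) (p : 'I_k.+1 * 'I_k.+1) :=
  (q * z (sigma p.1) - z (sigma p.2)) / (z (sigma p.1) - z (sigma p.2)).
exists (fun sigma => \prod_(p : 'I_k.+1 * 'I_k.+1 |
    (p.1 < p.2)%N && (p != (a, b))) G sigma p).
  move=> sigma; pose h (p : 'I_k.+1 * 'I_k.+1) := (tperm a b p.1, tperm a b p.2).
  have hK : involutive h by case=> l m; rewrite /h /= !tpermK.
  rewrite [RHS](reindex_inj (inv_inj hK)) /=; apply: eq_big => [[l m]|[l m] _] /=.
    rewrite /h /= !xpair_eqE.
    have E (j j' : 'I_k.+1) : (j == j') = (val j == val j') by [].
    move: va vb; case: (tpermP a b l) => [->|->|/eqP la /eqP lb];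
      case: (tpermP a b m) => [->|->|/eqP ma /eqP mb];
      rewrite ?E /= => va vb; try (move: la lb; rewrite !E /= => la lb);
      by try (move: ma mb; rewrite !E /= => ma mb); lia.
  by rewrite /G /h /= !permM.
move=> sigma; rewrite /scat pair_big_dep /= (bigD1 (a, b)) //=.
by rewrite va vb.
Qed.

Hypothesis nu_eq : nu * (1 - q + s) = s.
Hypothesis z_inj : injective z.
Hypothesis nuz_neq1 : forall i, nu * z i != 1.

Lemma bethe_two_body i g : (i.+1 < k.+1)%N ->
  e (inord i) = e (inord i.+1) ->
  (forall sigma, g (swap i sigma) = g sigma) ->
  wsum bethe_wt (fun t =>
    g t * (hop i t - q * hop i.+1 t - s * hop i t * hop i.+1 t)) = 0.
Proof.
move=> ik ei gi; set h := fun t => _.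
(* The summand changes sign under [swap i]. *)
suff H t : bethe_wt (swap i t) * h (swap i t) = - (bethe_wt t * h t).
  have : wsum bethe_wt h = - wsum bethe_wt h.
    rewrite {1}/wsum (reindex_inj (inv_inj (swapK i))) /=.
    by under eq_bigr do rewrite H; rewrite sumrN.
  by move/esym/eqP; rewrite eqNr => /eqP.
have [rest ri rE] := scat_swap ik.
have Y : \prod_(j < k.+1) y (swap i t j) ^ e j = \prod_(j < k.+1) y (t j) ^ e j.
  rewrite (reindex_inj (perm_inj (s := tperm (inord i) (inord i.+1)))) /=.
  apply: eq_bigr => j _; rewrite permM tpermK; congr (_ ^ _).
  by case: tpermP => // ->.
rewrite /bethe_wt Y /h gi !rE ri /hop !swapL !swapR.
set P := \prod_(j < k.+1) _.
have ab : t (inord i) != t (inord i.+1).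
  rewrite (inj_eq perm_inj); apply/eqP => /(congr1 val) /=.
  by rewrite !inordK; lia.
move: ab; set a := t (inord i); set b := t (inord i.+1) => ab.
have zab : z a - z b != 0 by rewrite subr_eq0 (inj_eq z_inj).
have zba : z b - z a != 0 by rewrite -opprB oppr_eq0.
have ha : 1 - nu * z a != 0 by rewrite subr_eq0 eq_sym.
have hb : 1 - nu * z b != 0 by rewrite subr_eq0 eq_sym.
have U c : 1 - nu * z c != 0 -> (y c)^-1 - 1 = (nu - 1) * z c / (1 - nu * z c).
  by move=> hc; rewrite /y invf_div; field.
rewrite !U //.
(* [nu_eq] cancels the [z c * z d] terms. The product of [z c - q * z d] with the scattering
   numerator [q * z c - z d] is symmetric, so the scattering denominator carries the sign. *)
have D c d : 1 - nu * z c != 0 -> 1 - nu * z d != 0 ->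
  (nu - 1) * z c / (1 - nu * z c) - q * ((nu - 1) * z d / (1 - nu * z d))
   - s * ((nu - 1) * z c / (1 - nu * z c)) * ((nu - 1) * z d / (1 - nu * z d))
  = (nu - 1) * (z c - q * z d) / ((1 - nu * z c) * (1 - nu * z d)).
  move=> hc hd; rewrite 2![s * _]mulrA.
  have -> : s * (nu - 1) = nu * (q - 1) by rewrite mulrBr mulr1 -{2}nu_eq; ring.
  by field; rewrite hc hd.
rewrite !D //; field.
by rewrite zab zba ha hb.
Qed.

End Bethe.

(** * From one cluster to all positions, and the eigenvalue *)

Lemma sum_clusters (F : nmodType) (f : nat -> F) (c : seq nat) :
  \sum_(i < size c) \sum_(l < nth 0%N c i) f (csum c i.+1 - l.+1)%N =
  \sum_(j < sumn c) f j.
Proof.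
elim: c f => [|n c IH] f /=; first by rewrite !big_ord0.
rewrite big_ord_recl big_split_ord /=; congr (_ + _).
  (* The left side counts positions from the right end of the cluster. *)
  rewrite (reindex_inj rev_ord_inj) /=; apply: eq_bigr => l _.
  by rewrite csum_cons /csum take0 /=; congr f; have := ltn_ord l; lia.
rewrite -(IH (fun j => f (n + j)%N)); apply: eq_bigr => i _.
apply: eq_bigr => -[l hl] _; congr f; rewrite /= csum_cons.
by have := csumS c i; move: hl; rewrite /= /bump add0n add1n; lia.
Qed.

Theorem proposition4p4 (R : realType) (k : nat) (hk : (2 <= k)%N) (s q : R[i])
  (hq : forall r : nat, (1 <= r <= k)%N -> qint q r != 0)
  (hs : forall n : nat, (0 < n)%N -> 1 + s * qint q n != 0)
  (hqs : 1 - q + s != 0)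
  (z : 'I_k -> R[i]) (hz : injective z)
  (hz1 : forall i : 'I_k, z i != 1)
  (hznu : forall i : 'I_k, (s / (1 - q + s)) * z i != 1) :
  let nu := s / (1 - q + s) in
  forall x : Lplus k,
    generator s q (Psi q nu z) x =
    (nu - 1) * (\sum_(i < k) z i / (1 - nu * z i)) * Psi q nu z x.
Proof.
move=> nu x; case: k => [|k] in hk hq z hz hz1 hznu x *; first by [].
have nu_eq : nu * (1 - q + s) = s by rewrite /nu divfK.
pose e i := sval x 0 i; pose wt := bethe_wt q nu z e.
pose u := hop nu z.
have [_ csz _ ceq] := (cluster_coordP x _).2 erefl.
rewrite /generator; set c := cluster_coord x in csz ceq *.
have y0 i : (1 - nu * z i) / (1 - z i) != 0.
  by rewrite mulf_neq0 ?invr_eq0 // subr_eq0 eq_sym.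
have PsiE : Psi q nu z x = \sum_sigma wt sigma by [].
(* A jump lowers the exponents of the last [r + 1] positions of the cluster by one, so each of them
   contributes a factor [1 + u]. *)
have jumpE (i : 'I_(size c)) (r : 'I_(nth 0%N c i)) :
  Psi q nu z (jump r) - Psi q nu z x =
  wsum wt (fun t => \prod_(p < r.+1) (1 + u (csum c i.+1 - p.+1)%N t) - 1).
  have /andP[ci cik] := cluster_coord_le x i; rewrite -/c in ci cik.
  rewrite wsumB; congr (_ - _); last first.
    by rewrite PsiE /wsum; under [RHS]eq_bigr do rewrite mulr1.
  have rm : (r < csum c i.+1)%N := leq_trans (ltn_ord r) ci.
  have jE j : sval (jump r) 0 j =
      e j - ((csum c i.+1 - r.+1 <= j < csum c i.+1)%N)%:R.
    by rewrite /= mxE [X in _ + X]mxE sum_basis_vecE.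
  rewrite /Psi /wsum; apply: eq_bigr => t _.
  rewrite /wt /bethe_wt -mulrA; congr (_ * _).
  under eq_bigr => j _.
    rewrite jE expfzDr //; over.
  rewrite big_split /=; congr (_ * _).
  rewrite (bigID (fun j : 'I_k.+1 => (csum c i.+1 - r.+1 <= j < csum c i.+1)%N)) /=.
  rewrite [X in _ * X]big1 ?mulr1; last by move=> j /negPf ->; rewrite oppr0 expr0z.
  have hp (p : 'I_r.+1) : (csum c i.+1 - p.+1 < k.+1)%N by lia.
  rewrite (reindex (fun p : 'I_r.+1 => Ordinal (hp p))) /=; last first.
    exists (fun j : 'I_k.+1 => inord (csum c i.+1 - j.+1)) => [p _|j].
      by apply: val_inj; rewrite /= inordK; have := ltn_ord p; lia.
    by rewrite inE => hj; apply: val_inj; rewrite /= inordK; lia.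
  apply: eq_big => [p|p ->]; first by have := ltn_ord p; lia.
  have -> : Ordinal (hp p) = inord (csum c i.+1 - p.+1).
    by apply: val_inj; rewrite /= inordK.
  by rewrite /u /hop [RHS]addrC subrK.
under eq_bigr => i _.
  under eq_bigr do rewrite jumpE.
  have hi := ltn_ord i; have ci := csumS c i.
  have cik := csum_sumn c i.+1.
  rewrite (@wsum_cluster _ s q _ wt (@swap k) u (csum c i) (csum c i.+1)) //.
  - over.
  - by move=> l j t *; apply: hop_swap => //; lia.
  - move=> l g li lh gi; apply: bethe_two_body => //; first by lia.
    pose b : 'I_k.+1 := inord (csum c i.+1).-1.
    have bE : b.+1 = csum c i.+1 by rewrite /= inordK; lia.
    by rewrite /e !(ceq i _ b) // inordK; lia.
  - by move=> r hr; apply: hq; lia.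
  - by rewrite ci.
rewrite /= (sum_clusters (fun j => wsum wt (u j))) csz.
rewrite /wsum exchange_big /= PsiE big_distrr /=; apply: eq_bigr => t _.
rewrite -big_distrr /= mulrC; congr (_ * _); rewrite big_distrr /=.
(* The sum of [u] over all positions is symmetric in [z]; reindexing by [t] removes the
   permutation. *)
rewrite [RHS](reindex_inj (perm_inj (s := t))) /=; apply: eq_bigr => j _.
rewrite /u /hop inord_val invf_div.
have h : 1 - nu * z (t j) != 0 by rewrite subr_eq0 eq_sym.
by field.
Qed.
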